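(* Let $d,N\ge 1$ be integers, put $s=d-1$, and let $F=F_1+\cdots+F_s+F_d$ and $G=G_1+\cdots+G_N$ be elements of $\mathbb{C}[x_1,\ldots,x_n]$, where $F_i$ and $G_j$ are homogeneous polynomials of degree $i$ and $j$, respectively. Assume that $F_d=h^d$ and $G_N=a_Nh^N$ for some homogeneous polynomial $h$ of degree $1$ and some $a_N\in\mathbb{C}\setminus\{0\}$. If $N\not\equiv 0\pmod d$ and $\deg[F,G]<d+i$ for some $i\in\{1,\ldots,N\}$ with $i<\frac{s}{d}N=\frac{d-1}{d}N$, then $F_s$ is divisible by $h$. In other words, there is a homogeneous polynomial $\tilde F_{s-1}$ of degree $s-1$ such that $F_s=\tilde F_{s-1}h$.
   Context: For $f,g\in\mathbb{C}[x_1,\ldots,x_n]$ the Poisson bracket is $[f,g]=\sum_{1\le i<j\le n}\left(\frac{\partial f}{\partial x_i}\frac{\partial g}{\partial x_j}-\frac{\partial f}{\partial x_j}\frac{\partial g}{\partial x_i}\right)[x_i,x_j]$, where $[x_i,x_j]=-[x_j,x_i]$ are formal symbols (linearly independent for $i<j$), and $\deg[f,g]=2+\max_{1\le i<j\le n}\deg\left(\frac{\partial f}{\partial x_i}\frac{\partial g}{\partial x_j}-\frac{\partial f}{\partial x_j}\frac{\partial g}{\partial x_i}\right)$, with $\deg 0=-\infty$. The zero polynomial counts as homogeneous of every degree.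
   Formalization: The linear form h is assumed nonzero; with the convention that 0 is homogeneous of every degree, h = 0 would be allowed and the claim fails (d=2, N=3, i=1, h=0, F=F_1=x_1, G=0). *)

(* Defs.v *)
From HB Require Import structures.
From mathcomp Require Import all_boot all_order all_algebra.
From mathcomp Require Import reals complex mpoly.
(* The notations of constructive_ereal clash with those of mpoly, hence the
   plain constructors [extended] (\bar), [EFin] (_%:E), [ENInf] (-oo) and [adde]. *)
From mathcomp Require Import -(notations) constructive_ereal.

Set Implicit Arguments.
Unset Strict Implicit.
Unset Printing Implicit Defensive.
Import Order.TTheory GRing.Theory Num.Theory.
Local Open Scope ring_scope.

(* Total degree with deg 0 = -oo; for nonzero p, msize p is 1 + deg p. *)
Definition pdeg (n : nat) (K : nzRingType) (p : {mpoly K[n]}) : extended int :=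
  if p == 0 then ENInf int else EFin (msize p).-1%:Z.

(* Index set of the formal symbols [x_i, x_j] with i < j. *)
Definition bracket_index (n : nat) : finType :=
  {ij : 'I_n * 'I_n | (ij.1 < ij.2)%N}.

(* The bracket lives in the free {mpoly K[n]}-module on the symbols
   [x_i, x_j], i < j, represented by the finite function of its coordinates. *)
Definition poisson (n : nat) (K : comNzRingType) (f g : {mpoly K[n]}) :
    {ffun bracket_index n -> {mpoly K[n]}} :=
  [ffun ij => let: (i, j) := val ij in
     f^`M(i) * g^`M(j) - f^`M(j) * g^`M(i)].

(* Each symbol [x_i, x_j] has degree 2; the result is -oo when all the
   coordinates vanish. *)
Definition bracket_deg (n : nat) (K : nzRingType)
    (u : {ffun bracket_index n -> {mpoly K[n]}}) : extended int :=
  adde (EFin 2) (\big[Order.max/ENInf int]_(ij : bracket_index n) pdeg (u ij)).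

(* Main.v *)
Require Import Defs.
From HB Require Import structures.
From mathcomp Require Import all_boot all_order all_algebra.
From mathcomp Require Import reals complex mpoly.
From mathcomp Require Import -(notations) constructive_ereal.
From mathcomp Require Import zify ring.

Set Implicit Arguments.
Unset Strict Implicit.
Unset Printing Implicit Defensive.
Import Order.TTheory GRing.Theory Num.Theory.
Local Open Scope ring_scope.

(* Let [f, g] stand for any coordinate of the bracket. If [h] divides every
   [h, P] and P is homogeneous of positive degree, contracting with the Euler
   field shows that [h] divides P. For k <= N - i the component of [F, G] of
   degree d + N - k vanishes, and by induction on k with dk <= N this forces
   G_(N-k) = h^(N-dk) (c F_s^k + h q) with c != 0. For k = floor(N/d) + 1, which
   is at most N - i because i < (s/d) N, the term d h^s [h, G_(N-k)] is too
   divisible by [h] to cancel the leading term coming from [F_s, G_(N-k+1)];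
   hence [h] divides [h, F_s^k], so it divides F_s^k and F_s. *)

(** * Divisibility and congruences between polynomials *)

Section Divisibility.
Variables (n : nat) (K : comNzRingType).
Implicit Types p q r : {mpoly K[n]}.

Definition mdvd p q := exists r, q = r * p.

Lemma mdvd_refl p : mdvd p p. Proof. by exists 1; rewrite mul1r. Qed.

Lemma mdvd0 p : mdvd p 0. Proof. by exists 0; rewrite mul0r. Qed.

Lemma mdvd_trans p q r : mdvd p q -> mdvd q r -> mdvd p r.
Proof. by move=> [u ->] [v ->]; exists (v * u); rewrite mulrA. Qed.

Lemma mdvdD p q r : mdvd p q -> mdvd p r -> mdvd p (q + r).
Proof. by move=> [u ->] [v ->]; exists (u + v); rewrite mulrDl. Qed.

Lemma mdvd_mull p q r : mdvd p q -> mdvd p (r * q).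
Proof. by move=> [u ->]; exists (r * u); rewrite mulrA. Qed.

Lemma mdvd_sum p (I : Type) (s : seq I) (P : pred I) (f : I -> {mpoly K[n]}) :
  (forall i, P i -> mdvd p (f i)) -> mdvd p (\sum_(i <- s | P i) f i).
Proof.
by move=> pf; elim/big_ind: _ => //; [apply: mdvd0 | move=> ? ?; apply: mdvdD].
Qed.

Lemma mdvd_exp p k l : (k <= l)%N -> mdvd (p ^+ k) (p ^+ l).
Proof. by move=> /subnK <-; exists (p ^+ (l - k)); rewrite exprD. Qed.

Lemma mdvd_exp_mulr p q k l : (k <= l)%N -> mdvd (p ^+ k) (p ^+ l * q).
Proof. by move=> kl; rewrite mulrC; apply/mdvd_mull/mdvd_exp. Qed.

Lemma mdvd_prod_congr p (I : Type) (s : seq I) (f g : I -> {mpoly K[n]}) :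
  (forall i, mdvd p (f i - g i)) ->
  mdvd p (\prod_(i <- s) f i - \prod_(i <- s) g i).
Proof.
move=> fg; elim: s => [|i s [v v_def]].
  by rewrite !big_nil subrr; apply: mdvd0.
have [u u_def] := fg i; rewrite !big_cons.
exists (u * (\prod_(j <- s) f j) + g i * v).
rewrite mulrDl mulrAC -u_def -mulrA -v_def; ring.
Qed.

Lemma mdvd_exp_congr p q r k : mdvd p (q - r) -> mdvd p (q ^+ k - r ^+ k).
Proof. by rewrite subrXX mulrC; apply: mdvd_mull. Qed.

(** Congruence modulo [p] passes to sums and products, so comparing variables suffices. Any
    polynomial killed by the substitution is thus a multiple of [p]. *)
Lemma mdvd_comp_congr (l : n.-tuple {mpoly K[n]}) p q :
  (forall i, mdvd p ('X_i - tnth l i)) -> mdvd p (q - (q \mPo l)).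
Proof.
move=> pl; elim/mpolyind: q => [|c m q _ _ IH].
  by rewrite comp_mpoly0 subr0; apply: mdvd0.
rewrite comp_mpolyD comp_mpolyZ opprD addrACA -scalerBr; apply: mdvdD => //.
rewrite -mul_mpolyC; apply: mdvd_mull; rewrite comp_mpolyX mpolyXE_id.
by apply: mdvd_prod_congr => i; apply: mdvd_exp_congr.
Qed.

End Divisibility.

(** * One coordinate of the Poisson bracket *)

Section Bracket.
Variables (n : nat) (K : comNzRingType) (a b : 'I_n).
Implicit Types f g p q : {mpoly K[n]}.

Definition brk f g := f^`M(a) * g^`M(b) - f^`M(b) * g^`M(a).

Lemma brkC f g : brk f g = - brk g f.
Proof. by rewrite /brk; ring. Qed.

Lemma brkxx f : brk f f = 0.
Proof. by rewrite /brk; ring. Qed.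

Lemma brk0r f : brk f 0 = 0.
Proof. by rewrite /brk !mderiv0 !mulr0 subr0. Qed.

Lemma brk0l f : brk 0 f = 0.
Proof. by rewrite brkC brk0r oppr0. Qed.

Lemma brkDr f p q : brk f (p + q) = brk f p + brk f q.
Proof. by rewrite /brk !mderivD; ring. Qed.

Lemma brkBr f p q : brk f (p - q) = brk f p - brk f q.
Proof. by rewrite /brk !mderivB; ring. Qed.

Lemma brkMr f p q : brk f (p * q) = brk f p * q + p * brk f q.
Proof. by rewrite /brk !mderivM; ring. Qed.

Lemma brkCMr f c p : brk f (c%:MP * p) = c%:MP * brk f p.
Proof. by rewrite /brk !mderiv_mulC; ring. Qed.

Lemma brkXr f p k : brk f (p ^+ k.+1) = k.+1%:R * p ^+ k * brk f p.
Proof.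
elim: k => [|k IH]; first by rewrite expr1 expr0; ring.
by rewrite exprS brkMr IH -[k.+2]addn1 natrD [p ^+ k.+1]exprS; ring.
Qed.

Lemma brk_suml (I : Type) (s : seq I) (P : pred I) (f : I -> {mpoly K[n]}) g :
  brk (\sum_(i <- s | P i) f i) g = \sum_(i <- s | P i) brk (f i) g.
Proof.
elim/big_rec2: _ => [|i p q _ <-]; first exact: brk0l.
by rewrite brkC brkDr opprD -!brkC.
Qed.

Lemma brk_sumr (I : Type) (s : seq I) (P : pred I) f (g : I -> {mpoly K[n]}) :
  brk f (\sum_(i <- s | P i) g i) = \sum_(i <- s | P i) brk f (g i).
Proof.
elim/big_rec2: _ => [|i p q _ <-]; first exact: brk0r.
by rewrite brkDr.
Qed.

(** Since [[p, p] = 0], powers of [p] are constants for the derivation [[p, -]]. *)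
Lemma brk_mull_exp p q k : brk p (q * p ^+ k) = brk p q * p ^+ k.
Proof.
rewrite brkMr; case: k => [|k]; last by rewrite brkXr brkxx; ring.
by rewrite expr0 /brk -mpolyC1 !mderivC; ring.
Qed.

Lemma mdvd_brk p f g k : mdvd (p ^+ k.+1) g -> mdvd (p ^+ k) (brk f g).
Proof.
move=> [q ->]; exists (brk f q * p + k.+1%:R * q * brk f p).
by rewrite brkMr brkXr exprS; ring.
Qed.

End Bracket.

(** * Euler's identity and graded components *)

Section Homogeneous.
Variable n : nat.

Lemma euler_mderiv (K : comNzRingType) (p : {mpoly K[n]}) e :
  p \is e.-homog -> \sum_(i < n) 'X_i * p^`M(i) = e%:R * p.
Proof.
move=> /dhomogP hp; rewrite {2}[p]mpolyE mulr_sumr.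
rewrite /mderiv; under eq_bigr do rewrite mulr_sumr.
rewrite exchange_big /= !big_seq; apply: eq_bigr => m /hp <-.
rewrite /= mdegE natr_sum mulr_suml; apply: eq_bigr => i _.
rewrite -scalerAr -mpolyXD [RHS]mulr_natl -[RHS]scaler_nat scalerA.
(* When [m i = 0] the truncated [m - U_(i)] does not undo adding [U_(i)], but its coefficient is
   zero. *)
have [->|mi] := eqVneq (m i) 0%N; first by rewrite !mul0r !scale0r.
by rewrite addmC submK ?lep1mP.
Qed.

Lemma dhomog_mderiv (K : comNzRingType) (p : {mpoly K[n]}) e i :
  p \is e.-homog -> p^`M(i) \is e.-1.-homog.
Proof.
move=> /dhomogP hp; rewrite /mderiv big_seq.
apply: rpred_sum => m /hp me.
have [->|mi] := eqVneq (m i) 0%N; first by rewrite mul0r scale0r rpred0.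
apply: rpredZ; rewrite dhomogX; apply/eqP.
have : mdeg (m - U_(i) + U_(i))%MM = e by rewrite submK ?lep1mP.
by rewrite mdegD mdeg1 addn1 => <-.
Qed.

Lemma dhomog_brk (K : comNzRingType) (p q : {mpoly K[n]}) d e a b :
  p \is d.-homog -> q \is e.-homog -> brk a b p q \is (d.-1 + e.-1).-homog.
Proof. by move=> hp hq; apply: rpredB; apply: dhomogM; apply: dhomog_mderiv. Qed.

(** Multiplying by the homogeneous [p] shifts graded components by [d], so [q] can be replaced by
    its component of degree [e]. *)
Lemma dhomog_quotient (K : comNzRingType) (p q r : {mpoly K[n]}) d e :
  p \is d.-homog -> r \is (d + e).-homog -> r = q * p ->
  exists2 q', q' \is e.-homog & r = q' * p.
Proof.
move=> hp hr rE; exists (pihomog mdeg e q); first exact: pihomogP.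
have pqE: pihomog mdeg (d + e) (q * p) = pihomog mdeg e q * p.
  rewrite [q](@pihomog_partitionE _ _ mdeg (maxn (msize q) e.+1)) ?leq_maxl //.
  set k := maxn _ _; have ek : (e < k)%N by rewrite leq_maxr.
  rewrite mulr_suml !linear_sum /= mulr_suml; apply: eq_bigr => c _.
  have hc : pihomog mdeg c q \is c.-homog by exact: pihomogP.
  have hcp := dhomogM hc hp.
  have [ce|ce] := eqVneq (c : nat) e.
    move: hc hcp; rewrite ce [(e + d)%N]addnC => hc hcp.
    by rewrite (pihomog_dE hc) (pihomog_dE hcp).
  rewrite (pihomog_ne0 ce hc) (pihomog_ne0 _ hcp) ?mul0r //.
  by rewrite addnC eqn_add2l.
by rewrite -pqE -rE pihomog_dE.
Qed.

End Homogeneous.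

(** * Divisibility by a nonzero linear form *)

Section LinearForm.
Variables (n : nat) (K : numFieldType) (h : {mpoly K[n]}).
Hypotheses (h_neq0 : h != 0) (homh : h \is 1.-homog).
Implicit Types p q : {mpoly K[n]}.

Lemma linear_mderiv i : exists c, h^`M(i) = c%:MP.
Proof.
have := dhomog_mderiv i homh; rewrite /= => /dhomogP h0.
exists (h^`M(i))@_0%MM; apply/mpolyP => m; rewrite mcoeffC.
have [->|m0] := eqVneq m 0%MM; first by rewrite mulr1.
rewrite mulr0; apply: memN_msupp_eq0; apply/negP => /h0 /eqP.
by rewrite mdeg_eq0 (negPf m0).
Qed.

Lemma linear_mderiv_neq0 : exists i, exists2 c, c != 0 & h^`M(i) = c%:MP.
Proof.
suff /existsP [i hi]: [exists i, h^`M(i) != 0].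
  by have [c hc] := linear_mderiv i; exists i, c; rewrite // -(mpolyC_eq0 n) -hc.
apply: contraNT h_neq0; rewrite negb_exists => /forallP h0.
have := euler_mderiv homh; rewrite mul1r => <-.
by rewrite big1 // => i _; move: (h0 i); rewrite negbK => /eqP ->; rewrite mulr0.
Qed.

(* Solving [h = 0] for a variable gives an endomorphism [phi] of the polynomial
   ring that kills [h] and is the identity modulo [h]; its target is a domain. *)
Lemma linear_prime p q : mdvd h (p * q) -> mdvd h p \/ mdvd h q.
Proof.
have [j [c c0 hj]] := linear_mderiv_neq0.
pose l := [tuple 'X_i - (if i == j then c^-1%:MP * h else 0) | i < n].
have l_congr (i : 'I_n) : mdvd h ('X_i - tnth l i).
  rewrite tnth_mktuple opprB addrC subrK.
  by case: ifP => _; [apply/mdvd_mull/mdvd_refl | apply: mdvd0].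
(* In Euler's formula for [h] the partial derivatives are constants, and only ['X_j] is changed: the
   substitution subtracts [c * (c^-1 * h) = h]. *)
have hl : h \mPo l = 0.
  have hE := euler_mderiv homh; rewrite mul1r in hE.
  rewrite -{1}hE raddf_sum /= (eq_bigr (fun i =>
      'X_i * h^`M(i) - (if i == j then h else 0))).
    by rewrite sumrB hE -big_mkcond big_pred1_eq subrr.
  move=> i _; have [ci hi] := linear_mderiv i.
  rewrite rmorphM /= hi comp_mpolyC comp_mpolyXU -tnth_nth tnth_mktuple mulrBl.
  case: eqP => [ij|_]; last by rewrite mul0r.
  move: hi; rewrite ij hj => <-; rewrite mulrAC -mpolyCM mulVf //.
  by rewrite mpolyC1 mul1r.
have dvdl r : r \mPo l = 0 -> mdvd h r.
  by move=> rl; have := mdvd_comp_congr r l_congr; rewrite rl subr0.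
move=> [r /(congr1 (comp_mpoly l))]; rewrite !rmorphM /= hl mulr0 => /eqP.
by rewrite mulf_eq0 => /orP[] /eqP /dvdl; [left | right].
Qed.

Lemma linear_prime_exp p k : mdvd h (p ^+ k) -> mdvd h p.
Proof.
elim: k => [h1|k IH]; first by rewrite -[p]mulr1; apply: mdvd_mull.
by rewrite exprS => /linear_prime [].
Qed.

(* Contracting [h_a p_b - h_b p_a] with the Euler field in the index [a] gives
   [h p_b - e h_b p], and some [h_b] is a nonzero constant. *)
Lemma mdvd_of_brk p e : p \is e.+1.-homog ->
  (forall a b, mdvd h (brk a b h p)) -> mdvd h p.
Proof.
move=> hp dvd_brk; have [j [c c0 hj]] := linear_mderiv_neq0.
have [q qE] : mdvd h (\sum_a 'X_a * brk a j h p).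
  by apply: mdvd_sum => a _; apply: mdvd_mull.
have sumE : \sum_a 'X_a * brk a j h p = h * p^`M(j) - h^`M(j) * (e.+1%:R * p).
  rewrite -(euler_mderiv hp) -{2}[h]mul1r -(euler_mderiv homh).
  rewrite mulr_suml mulr_sumr -sumrB.
  by apply: eq_bigr => a _; rewrite /brk; ring.
have ec0 : e.+1%:R * c != 0 by rewrite mulf_neq0 // pnatr_eq0.
exists ((e.+1%:R * c)^-1%:MP * (p^`M(j) - q)).
rewrite -mulrA mulrBl -qE sumE hj [p^`M(j) * h]mulrC opprB addrC subrK.
rewrite -mpolyC_nat !mulrA -!mpolyCM -mulrA [c * _]mulrC mulVf //.
by rewrite mpolyC1 mul1r.
Qed.

(** Factors of [h] are split off one at a time: [[h, q h] = [h, q] h], so the quotient inherits the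
    hypothesis with one power fewer. The bound [m <= e] keeps the degree positive at each use of
    [mdvd_of_brk]. *)
Lemma mdvd_exp_of_brk p e m : (m <= e)%N -> p \is e.-homog ->
  (forall a b, mdvd (h ^+ m) (brk a b h p)) -> mdvd (h ^+ m) p.
Proof.
elim: m e p => [|m IH] [|e] p // me hp dvd_brk.
- by exists p; rewrite expr0 mulr1.
- by exists p; rewrite expr0 mulr1.
have [|q pE] := mdvd_of_brk hp.
  move=> a b; apply: mdvd_trans (dvd_brk a b).
  by rewrite -{1}[h]expr1; apply: mdvd_exp.
have [q' hq' q'E] := dhomog_quotient (e := e) homh hp pE.
have [|a b|r rE] := IH e q' _ hq'; first by [].
  have [r] := dvd_brk a b.
  rewrite q'E -[X in q' * X]expr1 brk_mull_exp [h ^+ m.+1]exprSr mulrA.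
  by move=> hr; exists r; apply: (mulIf h_neq0).
by exists r; rewrite q'E rE exprSr mulrA.
Qed.

End LinearForm.

(** * Graded components of the bracket *)

Lemma pihomog_brk (n : nat) (K : comNzRingType) (F_ G_ : nat -> {mpoly K[n]})
    (d N : nat) (a b : 'I_n) (e : nat) :
  (forall k, (1 <= k <= d)%N -> F_ k \is k.-homog) ->
  (forall k, (1 <= k <= N)%N -> G_ k \is k.-homog) ->
  pihomog mdeg e
    (brk a b (\sum_(1 <= p < d.+1) F_ p) (\sum_(1 <= q < N.+1) G_ q)) =
  \sum_(1 <= p < d.+1) \sum_(1 <= q < N.+1 | (p + q == e + 2)%N)
    brk a b (F_ p) (G_ q).
Proof.
move=> homF homG; rewrite brk_suml linear_sum /=.
apply: eq_big_nat => p pd; rewrite brk_sumr linear_sum /= [RHS]big_mkcond /=.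
apply: eq_big_nat => q qN; have hpq := dhomog_brk a b (homF p pd) (homG q qN).
(* Each of the two derivatives lowers the degree by one, whence [e + 2]. *)
have [pq|pq] := eqVneq (p + q)%N (e + 2)%N.
  by rewrite pihomog_dE //; move: hpq; have -> : (p.-1 + q.-1 = e)%N by lia.
by apply: pihomog_ne0 hpq; lia.
Qed.

(** * Powers of [h] in the top components of [G] *)

Section LeadingTerms.
Variables (n : nat) (K : numFieldType) (h : {mpoly K[n]}).
Hypotheses (h_neq0 : h != 0) (homh : h \is 1.-homog).
Variables (s N i : nat) (F_ G_ : nat -> {mpoly K[n]}) (aN : K).
Hypotheses (s_gt0 : (0 < s)%N) (i_gt0 : (0 < i)%N).
Hypothesis homF : F_ s \is s.-homog.
Hypothesis homG : forall k, (1 <= k <= N)%N -> G_ k \is k.-homog.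
Hypotheses (aN_neq0 : aN != 0) (defFd : F_ s.+1 = h ^+ s.+1).
Hypothesis defGN : G_ N = aN *: h ^+ N.
Hypothesis brk_eq0 : forall a b e, (s.+1 + i <= e + 2)%N ->
  \sum_(1 <= p < s.+2) \sum_(1 <= q < N.+1 | (p + q == e + 2)%N)
    brk a b (F_ p) (G_ q) = 0.

(** Here [s.+1] plays the role of [d]. The scalar is a parameter so that [c != 0] can be tracked
    where it matters. *)
Definition leading_form k c := exists q,
  G_ (N - k) = h ^+ (N - s.+1 * k) * (c%:MP * F_ s ^+ k + h * q).

(** In the vanishing sum over [p + q = s + N - k], the terms [p = s + 1] and [p = s] produce the two
    expressions; those with [p < s] involve earlier leading forms, hence higher powers of [h]. *)
Lemma brk_congr k c :
  (k < N - i)%N -> (s.+1 * k < N)%N ->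
  (forall l, (l < k)%N -> exists c', leading_form l c') -> leading_form k c ->
  forall a b, mdvd (h ^+ (N - s.+1 * k))
    (s.+1%:R * h ^+ s * brk a b h (G_ (N - k.+1))
     - (N - s.+1 * k)%:R * c%:MP * h ^+ (N - s.+1 * k).-1
       * (F_ s ^+ k * brk a b h (F_ s))).
Proof.
move=> kNi dkN lead_lt [q qE] a b.
set M := (N - s.+1 * k)%N; have M_gt0 : (0 < M)%N by rewrite subn_gt0.
(* The bound [k < N - i] is exactly what puts this [e] in the range of [brk_eq0]. *)
have [e eE] : exists e, (e + 2 = s + N - k)%N by exists (s + N - k - 2)%N; lia.
have := brk_eq0 a b (e := e); rewrite eE => /(_ ltac:(lia)).
rewrite big_nat_recr //= big_nat_recr //=.
rewrite [X in _ + X + _](eq_bigl (fun q => q == N - k)%N); last by move=> x; lia.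
rewrite [X in _ + _ + X](eq_bigl (fun q => q == N - k.+1)%N); last by move=> x; lia.
rewrite !big_nat1_eq !ifT ?qE -?/M; [|lia|lia].
set rest := (X in X + _ + _ = 0) => rest_eq.
have [r restE] : mdvd (h ^+ M) rest.
  rewrite /rest big_nat_cond; apply: mdvd_sum => p; rewrite andbT => ps.
  rewrite big_nat_cond; apply: mdvd_sum => x /andP [xN px]; apply: mdvd_brk.
  (* [G_ x] contains [h] to the power [M + (s + 1)(s - p)]; the bracket costs one factor, and
     [p < s] still leaves at least [M]. *)
  have xE : x = (N - (k - (s - p)))%N by lia.
  have [|c' [q' GE]] := lead_lt (k - (s - p))%N; first by lia.
  rewrite xE GE; apply: mdvd_exp_mulr; rewrite /M mulnBr.
  have : (s.+1 <= s.+1 * (s - p))%N by rewrite leq_pmulr // subn_gt0; case/andP: ps.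
  have : (s.+1 * (s - p) <= s.+1 * k)%N by rewrite leq_mul2l; lia.
  lia.
move: rest_eq; rewrite restE defFd [brk _ _ (h ^+ s.+1) _]brkC brkXr.
rewrite [brk _ _ _ h]brkC => rest_eq.
have [M' ME] : exists M', M = M'.+1 by exists M.-1; rewrite prednK.
rewrite ME /= in rest_eq *; move: rest_eq; rewrite brkMr brkXr [brk _ _ _ h]brkC.
set B := brk _ _ (F_ s) (_ + _) => rest_eq.
(* The cofactors of [h ^+ M] come from the correction [h * q], from the terms [p < s], and from the
   derivative falling on the second factor of [G_ (N - k)]. *)
exists (M'.+1%:R * q * brk a b h (F_ s) - r - B).
apply/eqP; rewrite -subr_eq0; apply/eqP; rewrite -[RHS]rest_eq [h ^+ M'.+1]exprS.
ring.
Qed.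
(** A suitable multiple of [F_s^(k+1) h^m] is subtracted from [G_(N-k-1)] so that the main terms of
    [brk_congr] cancel; then [h^(m+1)] divides [[h, P]], hence the difference [P]. *)
Lemma leading_form_exists k :
  (k <= N - i)%N -> (s.+1 * k <= N)%N -> exists2 c, c != 0 & leading_form k c.
Proof.
elim/ltn_ind: k => -[_ _ _|k IH kNi dkN].
  exists aN => //; exists 0.
  by rewrite subn0 muln0 subn0 defGN expr0 !(mulr0, mulr1, addr0) mulrC mul_mpolyC.
have dkS : (s.+1 * k.+1 = s.+1 * k + s.+1)%N by rewrite mulnS addnC.
have [//|||c c_neq0 lead_k] := IH k; try lia.
have lead_lt l : (l < k)%N -> exists c', leading_form l c'.
  move=> lk; have : (s.+1 * l <= s.+1 * k)%N by rewrite leq_mul2l ltnW ?orbT.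
  by move=> dlk; have [|||c' _ lead_l] := IH l; try lia; exists c'.
set m := (N - s.+1 * k.+1)%N.
have ME : (N - s.+1 * k = (m + s).+1)%N by lia.
pose M : K := (m + s).+1%:R; pose D : K := s.+1%:R.
have D_neq0 : D != 0 by rewrite pnatr_eq0.
have k_neq0 : k.+1%:R != 0 :> K by rewrite pnatr_eq0.
have M_neq0 : M != 0 by rewrite pnatr_eq0.
(* Cancellation requires [D (k + 1) c' = M c]; characteristic zero gives [c' != 0]. *)
pose c' := M * c / (D * k.+1%:R).
exists c'; first by rewrite !mulf_neq0 ?invr_eq0 ?mulf_neq0.
pose P := G_ (N - k.+1) - c'%:MP * (F_ s ^+ k.+1 * h ^+ m).
have homP : P \is (N - k.+1).-homog.
  apply: rpredB; first by apply: homG; lia.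
  rewrite mul_mpolyC; apply: rpredZ.
  have -> : (N - k.+1 = s * k.+1 + 1 * m)%N by rewrite /m mulSn; lia.
  by apply: dhomogM; apply: dhomogMn.
have [||r PE] := mdvd_exp_of_brk h_neq0 homh (m := m.+1) _ homP.
- rewrite /m mulSn; have : (0 < s * k.+1)%N by rewrite muln_gt0 s_gt0.
  lia.
- move=> a b; have [||q] := brk_congr _ _ lead_lt lead_k a b; try lia.
  rewrite ME /= => qE; exists (D^-1%:MP * q).
  have D1 : s.+1%:R * D^-1%:MP = 1 :> {mpoly K[n]}.
    by rewrite -mpolyC_nat -mpolyCM mulfV.
  have c'E : s.+1%:R * k.+1%:R * c'%:MP = (m + s).+1%:R * c%:MP :> {mpoly K[n]}.
    rewrite -!mpolyC_nat -!mpolyCM; congr (_%:MP).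
    by rewrite mulrC divfK // mulf_neq0.
  have Dhs_neq0 : s.+1%:R * h ^+ s != 0.
    by rewrite mulf_neq0 ?expf_neq0 // -mpolyC_nat mpolyC_eq0.
  (* The modulus of [brk_congr] is [h ^+ (m + 1 + s)]; cancelling [s.+1 * h ^+ s] leaves
     [h ^+ (m + 1)]. *)
  apply: (mulfI Dhs_neq0); rewrite /P brkBr brkCMr brk_mull_exp brkXr.
  transitivity (s.+1%:R * h ^+ s * brk a b h (G_ (N - k.+1))
    - s.+1%:R * k.+1%:R * c'%:MP * h ^+ (m + s) * (F_ s ^+ k * brk a b h (F_ s))).
    by rewrite exprD; ring.
  rewrite c'E qE; transitivity (s.+1%:R * D^-1%:MP * (q * h ^+ m.+1 * h ^+ s)).
    by rewrite D1 mul1r -addSn exprD mulrA.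
  by ring.
exists r; rewrite -[LHS](subrK (c'%:MP * (F_ s ^+ k.+1 * h ^+ m))) -/P PE -/m exprS.
by ring.
Qed.

(** With [k = N %/ s.+1] the exponent [N - s.+1 * k] is the remainder: nonzero, so the surviving
    coefficient does not vanish, and at most [s], so [h ^+ s] absorbs it. *)
Lemma mdvd_subleading :
  ~~ (s.+1 %| N)%N -> (N < s.+1 * (N - i))%N -> mdvd h (F_ s).
Proof.
move=> ndvd i_lt; set k := (N %/ s.+1)%N.
have NE := divn_eq N s.+1; rewrite -/k mulnC in NE.
have M_lt : (N %% s.+1 < s.+1)%N by rewrite ltn_mod.
have M_gt0 : (0 < N %% s.+1)%N by rewrite lt0n.
have kNi : (k < N - i)%N by rewrite ltn_divLR // mulnC.
have [||c c_neq0 lead_k] := leading_form_exists (k := k); try lia.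
have lead_lt l : (l < k)%N -> exists c', leading_form l c'.
  move=> lk; have : (s.+1 * l <= s.+1 * k)%N by rewrite leq_mul2l ltnW ?orbT.
  move=> dlk; have [||c' _ lead_l] := leading_form_exists (k := l); try lia.
  by exists c'.
have [M' ME] : exists M', (N - s.+1 * k = M'.+1)%N.
  by exists (N %% s.+1).-1; lia.
have M's : (M' < s)%N by lia.
have dvd_brk a b : mdvd h (brk a b h (F_ s ^+ k.+1)).
  have [||q] := brk_congr _ _ lead_lt lead_k a b; try lia.
  rewrite ME /= => qE; rewrite brkXr -mulrA; apply: mdvd_mull.
  have Mc_neq0 : M'.+1%:R * c != 0 by rewrite mulf_neq0 // pnatr_eq0.
  (* As [h ^+ s] is a multiple of [h ^+ M'.+1], so is the term containing [F_ s]; cancelling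
     [h ^+ M'] leaves one factor [h]. *)
  have [t sE] : exists t, s = (t.+1 + M')%N by exists (s - M'.+1)%N; lia.
  exists ((M'.+1%:R * c)^-1%:MP *
    (s.+1%:R * h ^+ t * brk a b h (G_ (N - k.+1)) - q)).
  apply: (mulfI (expf_neq0 M' h_neq0)).
  have -> : h ^+ M' * (F_ s ^+ k * brk a b h (F_ s)) = (M'.+1%:R * c)^-1%:MP *
     (M'.+1%:R * c%:MP * h ^+ M' * (F_ s ^+ k * brk a b h (F_ s))).
    transitivity ((M'.+1%:R * c)^-1%:MP * (M'.+1%:R * c%:MP) *
        (h ^+ M' * (F_ s ^+ k * brk a b h (F_ s)))); last by ring.
    by rewrite -mpolyC_nat -!mpolyCM mulVf // mpolyC1 mul1r.
  set A := _ * _ * _ * (_ * _) in qE *.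
  have -> : A = s.+1%:R * h ^+ s * brk a b h (G_ (N - k.+1)) - q * h ^+ M'.+1.
    by rewrite -qE opprB addrC subrK.
  have -> : h ^+ s = h ^+ t.+1 * h ^+ M' by rewrite -exprD -sE.
  by rewrite !exprS; move: (_^-1%:MP) => u; ring.
apply: (@linear_prime_exp _ _ _ h_neq0 homh _ k.+1).
apply: (mdvd_of_brk h_neq0 homh (e := (s * k.+1).-1) _ dvd_brk).
by rewrite prednK ?muln_gt0 ?s_gt0 //; apply: dhomogMn.
Qed.

End LeadingTerms.

(** * From the degree bound to vanishing components, and the theorem *)

Lemma pihomog_ge_msize (n : nat) (K : nzRingType) (p : {mpoly K[n]}) e :
  (msize p <= e)%N -> pihomog mdeg e p = 0.
Proof.
move=> pe; rewrite pihomogE big_seq_cond big1 // => m /andP [mp /eqP me].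
by have := msize_mdeg_lt mp; rewrite me ltnNge pe.
Qed.

Lemma pihomog_brk_eq0 (n : nat) (K : comNzRingType) (f g : {mpoly K[n]})
    (D e : nat) (a b : 'I_n) :
  (bracket_deg (poisson f g) < EFin D%:Z)%O -> (D <= e + 2)%N ->
  pihomog mdeg e (brk a b f g) = 0.
Proof.
(* Coordinates exist only for [a < b]; antisymmetry covers the other pairs. *)
move=> deg_lt De; wlog ab : a b / (a < b)%N.
  move=> IH; case: (ltngtP a b) => [/IH //|/IH|/val_inj ->].
    by move=> ba; rewrite /brk -opprB pihomogN [pihomog _ _ _]ba oppr0.
  by rewrite /brk subrr pihomog0.
pose ij : bracket_index n :=
  exist (fun ij : 'I_n * 'I_n => (ij.1 < ij.2)%N) (a, b) ab.
have := le_bigmax (ENInf int) (fun ij => pdeg (poisson f g ij)) ij.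
(* A maximum [-oo] makes the coordinate zero; a finite maximum [x] has [2 + x < D <= e + 2], so the
   coordinate has degree below [e]. *)
move: deg_lt; rewrite /bracket_deg; case: (\big[_/_]_ij _) => [x|//|] /=; last first.
  rewrite /pdeg ffunE /=; case: eqP => // fg0 _ _.
  by rewrite [brk _ _ _ _]fg0 pihomog0.
rewrite /pdeg ffunE /= => x_lt; case: eqP => [fg0 _|_ deg_le].
  by rewrite [brk _ _ _ _]fg0 pihomog0.
apply: pihomog_ge_msize; move: x_lt deg_le; rewrite -/(brk a b f g).
rewrite -[adde _ _]/(EFin (2 + x)) lte_fin lee_fin; lia.
Qed.

Theorem theorem5p1 (R : realType) (n d N s : nat)
  (hd : (1 <= d)%N) (hN : (1 <= N)%N) (hs : s = (d - 1)%N)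
  (F_ G_ : nat -> {mpoly R[i][n]})
  (homF : forall k : nat, (1 <= k <= d)%N -> F_ k \is k.-homog)
  (homG : forall k : nat, (1 <= k <= N)%N -> G_ k \is k.-homog)
  (F G : {mpoly R[i][n]})
  (defF : F = \sum_(1 <= k < s.+1) F_ k + F_ d)
  (defG : G = \sum_(1 <= k < N.+1) G_ k)
  (h : {mpoly R[i][n]}) (h_neq0 : h != 0) (homh : h \is 1.-homog)
  (aN : R[i]) (aN_neq0 : aN != 0)
  (defFd : F_ d = h ^+ d) (defGN : G_ N = aN *: h ^+ N)
  (ndvd : (N != 0 %[mod d])%N)
  (i : nat) (i_range : (1 <= i <= N)%N)
  (i_lt : (i%:R < s%:R / d%:R * N%:R :> rat))
  (deg_lt : (bracket_deg (poisson F G) < EFin (d + i)%:Z)%O) :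
  exists2 Ft : {mpoly R[i][n]}, Ft \is (s - 1).-homog & F_ s = Ft * h.
Proof.
(* [s = 0] means [d = 1], which divides [N], against [ndvd]. *)
case: s => [|s] in hs i_lt defF *.
  have d1 : d = 1%N by lia.
  by rewrite d1 !modn1 in ndvd.
have dE : d = s.+2 by lia.
subst d; have {}i_lt : (i * s.+2 < s.+1 * N)%N.
  move: i_lt; rewrite mulrAC ltr_pdivlMr ?ltr0n //.
  by rewrite -!natrM ltr_nat.
have homFs : F_ s.+1 \is s.+1.-homog by apply: homF; lia.
have FE : F = \sum_(1 <= k < s.+3) F_ k by rewrite defF [RHS]big_nat_recr.
have [q qE] : mdvd h (F_ s.+1).
  apply: (@mdvd_subleading _ _ h h_neq0 homh s.+1 N i F_ G_ aN) => //.
  - by case/andP: i_range.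
  - move=> a b e e_ge; rewrite -pihomog_brk // -FE -defG.
    exact: pihomog_brk_eq0 deg_lt e_ge.
  (* [i d < (d - 1) N] rearranges to [N < d (N - i)]. *)
  - by rewrite mulnBr; lia.
have [Ft homFt FtE] := dhomog_quotient (e := s) homh homFs qE.
by exists Ft; rewrite // subn1.
Qed.
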